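(* There is a universal constant $C>0$ such that the following holds. Let $\tau>0$, $B>0$, let $P$ be a probability measure on a measurable space $(\Omega,\mathcal F)$, let $X:\Omega\to[-B,B]$ be measurable, and let $\mathcal R(X)=\sup\{\mathbb E_Q[X]:\ \mathrm{KL}(Q\Vert P)+\mathrm{KL}(P\Vert Q)\le\tau\}$. For any $\delta\in(0,1)$ and $\epsilon\in(0,B]$, put $$h=\frac{B^2\exp(4\tau B/\epsilon)}{\epsilon^2},\qquad \Lambda=\log\Big(e+h+B+\frac1B+\frac1\epsilon+\tau+\frac1\tau+\frac1\delta\Big).$$ Then $|\mathcal R(X)-\mathcal R_n(X)|\le\epsilon$ with probability at least $1-\delta$ whenever $n\ge C\,\Lambda^{C}\,h$; that is, the number of samples needed is bounded by $\tilde{O}\big(B^2\exp(4\tau B/\epsilon)/\epsilon^2\big)$.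
   Context: The supremum is over probability measures $Q\ll P$ on $(\Omega,\mathcal F)$; $\mathrm{KL}(Q\Vert P)=\int\log\frac{dQ}{dP}\,dQ$ if $Q\ll P$ and $+\infty$ otherwise. (Equivalently, the divergence function is $\phi(x)=(x-1)\log x$ for $x>0$, $+\infty$ for $x\le0$, and $\mathcal R(X)=\sup\{\int X\zeta\,dP:\zeta\ge0,\int\zeta\,dP=1,\int\phi(\zeta)\,dP\le\tau\}$; this is the Jeffreys divergence.) $P_n$ is the empirical distribution of $n$ i.i.d. samples from $P$, and $\mathcal R_n(X)$ is the same quantity with $P$ replaced by $P_n$. *)

(* Defs.v *)
From HB Require Import structures.
From mathcomp Require Import all_boot all_order all_algebra.
From mathcomp Require Import all_classical all_reals all_analysis.

Set Implicit Arguments.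
Unset Strict Implicit.
Unset Printing Implicit Defensive.

Import Order.TTheory GRing.Theory Num.Theory.
Import numFieldNormedType.Exports.

Local Open Scope classical_set_scope.
Local Open Scope ring_scope.

Section divergence.
Local Open Scope ereal_scope.
Local Open Scope charge_scope.
Context d (T : measurableType d) (R : realType).

(* [lne 0 = -oo] is harmless: the derivative vanishes only on a [Q]-null set. *)
Definition KL (Q P : probability T R) : \bar R :=
  if `[< Q `<< P >]
  then \int[Q]_x lne (('d (charge_of_finite_measure Q) '/d P) x)
  else +oo.

Definition jeffreys_risk (P : probability T R) (tau : R) (X : T -> R) : \bar R :=
  ereal_sup [set 'E_Q[X] | Q in
    [set Q : probability T R | Q `<< P /\ KL Q P + KL P Q <= tau%:E]].

End divergence.

Section empirical.
Local Open Scope ereal_scope.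
Context d (T : measurableType d) (R : realType).
Variables (n : nat) (x : 'I_n.+1 -> T).

(* [msum] takes a [nat]-indexed family and only reads its first [n.+1] terms,
   on which [inord] is the identity. *)
Definition empirical : set T -> \bar R :=
  mscale (n.+1%:R^-1 : R)%R%:nng%R (msum (fun k => \d_(x (inord k))) n.+1).

Lemma empiricalE (A : set T) :
  empirical A = (n.+1%:R^-1)%R%:E * \sum_(i < n.+1) \d_(x i) A.
Proof.
rewrite /empirical /mscale /msum /=; congr (_ * _).
by apply: eq_bigr => i _; rewrite inord_val.
Qed.

HB.instance Definition _ := Measure.on empirical.

Let empirical_setT : empirical setT = 1.
Proof.
rewrite empiricalE (eq_bigr (fun=> 1%:E)); last by move=> i _; exact: diracT.
by rewrite sumEFin -EFinM sumr_const card_ord mulVf.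
Qed.

HB.instance Definition _ :=
  Measure_isProbability.Build _ _ _ empirical empirical_setT.

End empirical.

Section sampling.
Local Open Scope ereal_scope.
Context d (S : measurableType d) (R : realType) (Pr : probability S R).
Context d' (T : measurableType d').

Definition mutually_independent (I : finType) (xi : I -> {RV Pr >-> T}) : Prop :=
  forall (J : {set I}) (A : I -> set T), (forall i, measurable (A i)) ->
    Pr (\bigcap_(i in [set` J]) (xi i @^-1` A i)) =
    \prod_(i in J) Pr (xi i @^-1` A i).

Definition iid (P : probability T R) (I : finType) (xi : I -> {RV Pr >-> T}) :
    Prop :=
  mutually_independent xi /\
  forall i A, measurable A -> distribution Pr (xi i) A = P A.

(* The value of [Pr] on a nonmeasurable set is unspecified, whence an inner
   probability; see [with_prob_geE] for measurable events. *)
Definition with_prob_ge (p : \bar R) (E : set S) : Prop :=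
  exists A, [/\ measurable A, A `<=` E & p <= Pr A].

Lemma with_prob_geE p E : measurable E -> with_prob_ge p E <-> p <= Pr E.
Proof.
move=> mE; split=> [[A [mA AE pA]]|pE]; last by exists E; split.
by apply: (le_trans pA); apply: le_measure => //; exact: mem_set.
Qed.

End sampling.

(* Main.v *)
Require Import Defs.
From HB Require Import structures.
From mathcomp Require Import all_boot all_order all_algebra.
From mathcomp Require Import all_classical all_reals all_analysis.
From mathcomp Require Import measurable_realfun ring lra.

(* Rounding [X] to finitely many values [v i] changes both risks by a small
   multiple of [epsilon], and only the masses [p i] of the level sets of [X]
   matter. Write [phi z = (z - 1) ln z]. For the true masses [p], the
   intermediate value theorem gives multipliers [lam >= epsilon / (2 tau)] and
   [mu] and weights [z i > 0] with [lam * phi^`() (z i) = v i - mu], total mass 1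
   and divergence at most [tau]; the duality gap is 0 if the divergence
   constraint is active, and otherwise [lam] takes its least value and the gap is
   at most [lam * tau = epsilon / 2]. The lower bound on [lam] forces
   [|ln (z i)| <= 4 tau B / epsilon], whence the exponential in the sample size.

   Weak duality for the empirical masses, with the same multipliers, bounds the
   empirical risk above by an empirical mean of the Legendre transform of [phi];
   conversely [z], contracted slightly towards 1 and renormalized, is feasible
   for the empirical masses. Since [z] is deterministic, only the empirical means
   of five fixed functions need to concentrate, and Bernstein's inequality
   applies: their second moments are linear, not quadratic, in [max z]. *)

Set Implicit Arguments.
Unset Strict Implicit.
Unset Printing Implicit Defensive.

Import Order.TTheory GRing.Theory Num.Theory.
Import numFieldNormedType.Exports.
Local Open Scope classical_set_scope.
Local Open Scope ring_scope.

(** * The divergence function *)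

(** Combine [expR x * (1 - x) <= 1] with [(1 + x + 2 x^2)(1 - x) = 1 + x^2 (1 - 2 x) >= 1]. *)
Lemma expR_le_quadratic (R : realType) (x : R) :
  x <= 2^-1 -> expR x <= 1 + x + 2 * x ^+ 2.
Proof.
move=> x2; have x1 : 0 < 1 - x by lra.
have e1 : 1 - x <= expR (- x) by have := expR_ge1Dx (- x).
have e2 : expR x * (1 - x) <= 1.
  by rewrite (le_trans (ler_wpM2l (expR_ge0 x) e1))// expRxMexpNx_1.
rewrite -(ler_pM2r x1) (le_trans e2)//.
have h : 0 <= x ^+ 2 * (1 - 2 * x) by rewrite mulr_ge0 ?sqr_ge0//; lra.
lra.
Qed.

(** * Inverse of the slope of the divergence function *)

Section tilt.
Context {R : realType}.
Implicit Types u y : R.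

(** Since [1 - expR (- y)] has the sign of [y], the map is below the identity at [- |u|] and above
    it at [|u|]; the intermediate value theorem concludes. *)
Lemma tilt_subproof u : exists y, y + 1 - expR (- y) = u.
Proof.
have k_cont : continuous (fun y : R => y + 1 - expR (- y)).
  move=> y; apply: cvgB; first by apply: cvgD; [exact: cvg_id|exact: cvg_cst].
  by apply: continuous_comp; [exact: opp_continuous|exact: continuous_expR].
have e0 : - `|u| <= `|u| by rewrite ge0_cp.
have [||y _ <-] := @IVT R (fun y => y + 1 - expR (- y)) (- `|u|) `|u| u e0.
- exact: continuous_subspaceT.
- have h1 : `|u| <= `|u| + 1 - expR (- `|u|).
    by rewrite -addrA lerDl subr_ge0 -[leRHS]expR0 ler_expR oppr_le0.
  have h2 : - `|u| + 1 - expR (- - `|u|) <= - `|u|.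
    by rewrite -addrA gerDl subr_le0 opprK -[leLHS]expR0 ler_expR.
  rewrite ge_min le_max; apply/andP; split; apply/orP.
    by left; rewrite (le_trans h2)// lerNl -normrN ler_norm.
  by right; rewrite (le_trans _ h1)// ler_norm.
- by exists y.
Qed.

(* With [phi z = (z - 1) ln z], [expR \o tilt] is the inverse of
   [phi^`() z = ln z + 1 - z^-1]. *)
Definition tilt u : R := sval (cid (tilt_subproof u)).

Lemma tiltE u : tilt u + 1 - expR (- tilt u) = u.
Proof. by rewrite /tilt; case: cid. Qed.

Lemma tilt_lt u u' : u < u' -> tilt u < tilt u'.
Proof.
move=> uu'; rewrite ltNge; apply/negP => h.
have : u' <= u.
  by rewrite -(tiltE u) -(tiltE u') lerB ?lerD2r// ler_expR lerN2.
by rewrite leNgt uu'.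
Qed.

Lemma tilt_le u u' : u <= u' -> tilt u <= tilt u'.
Proof. by rewrite le_eqVlt => /orP[/eqP-> //|/tilt_lt/ltW]. Qed.

(** The map inverted by [tilt] is the identity plus an increasing function, so it expands
    distances. *)
Lemma tilt_lip u u' : `|tilt u - tilt u'| <= `|u - u'|.
Proof.
wlog h : u u' / u <= u' => [W|].
  by case/orP: (le_total u u') => h; [|rewrite distrC (distrC u)]; exact: W.
have h' := tilt_le h.
rewrite distrC ger0_norm ?subr_ge0// distrC ger0_norm ?subr_ge0//.
have : expR (- tilt u') <= expR (- tilt u) by rewrite ler_expR lerN2.
move: (tiltE u) (tiltE u'); lra.
Qed.

Lemma tilt0 : tilt 0 = 0.
Proof.
have := tiltE 0; set y := tilt 0 => hy.
have [y0|y0|//] := ltgtP y 0.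
  have : 1 <= expR (- y) by rewrite -[leLHS]expR0 ler_expR; lra.
  lra.
have : expR (- y) <= 1 by rewrite -[leRHS]expR0 ler_expR; lra.
lra.
Qed.

Lemma tilt_continuous : continuous tilt.
Proof.
move=> u; apply/cvgrPdist_le => /= e e0; near=> t.
rewrite (le_trans (tilt_lip _ _))//; near: t; exact: (cvgr_dist_le (@cvg_id _ (nbhs u))).
Unshelve. all: by end_near. Qed.

Lemma normr_tilt u : `|tilt u| <= `|u|.
Proof. by have := tilt_lip u 0; rewrite tilt0 !subr0. Qed.

(** [tilt u] and [1 - expR (- tilt u)] have the same sign and sum to [u]. *)
Lemma normr_subr1_expRN_tilt u : `|1 - expR (- tilt u)| <= `|u|.
Proof.
have := tiltE u; set y := tilt u => <-.
have [y0|/ltW y0] := leP 0 y.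
  have : expR (- y) <= 1 by rewrite -[leRHS]expR0 ler_expR; lra.
  by move=> h; rewrite !ger0_norm; lra.
have : 1 <= expR (- y) by rewrite -[leLHS]expR0 ler_expR; lra.
by move=> h; rewrite !ler0_norm; lra.
Qed.

End tilt.

(** * Contraction of weights towards 1, and renormalization *)

Section contraction.
Context {R : realType}.
Implicit Types s t z : R.

Definition jphi z : R := (z - 1) * ln z.

Lemma ln_ge_subr1V z : 0 < z -> 1 - z^-1 <= ln z.
Proof.
move=> z0; have : ln z^-1 <= z^-1 - 1.
  have := @le_ln1Dx R (z^-1 - 1); rewrite addrCA subrr addr0; apply.
  by rewrite ltrBrDl subrr invr_gt0.
rewrite lnV ?posrE//; lra.
Qed.

Lemma ln_le_subr1 z : 0 < z -> ln z <= z - 1.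
Proof.
move=> z0; have := @le_ln1Dx R (z - 1); rewrite addrCA subrr addr0; apply; lra.
Qed.

(** The factor [z - 1] is scaled by [t], and [ln] is taken at a point between 1 and [z], which only
    brings it closer to 0. *)
Lemma jphi_contract t z : 0 < z -> 0 <= t <= 1 ->
  jphi (1 + t * (z - 1)) <= t * jphi z.
Proof.
move=> z0 /andP[t0 t1]; rewrite /jphi [1 + _]addrC addrK -mulrA [_ + 1]addrC.
rewrite ler_wpM2l//; have [z1|/ltW z1] := leP 1 z.
  have h : 0 <= (1 - t) * (z - 1) by rewrite mulr_ge0; lra.
  have h' : 0 <= t * (z - 1) by rewrite mulr_ge0; lra.
  by rewrite ler_wpM2l ?ler_ln ?posrE; lra.
have h : 0 <= (1 - t) * (1 - z) by rewrite mulr_ge0; lra.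
by rewrite ler_wnM2l ?ler_ln ?posrE; lra.
Qed.

(** After removing a factor [z - 1], this follows from [1 - z^-1 <= ln z] above 1 and from
    [ln z <= z - 1] below 1. *)
Lemma jphi_ge z : 0 < z -> (z - 1) ^+ 2 <= jphi z * (z + 1).
Proof.
move=> z0; rewrite /jphi expr2 -mulrA; have [z1|/ltW z1] := leP 1 z.
  rewrite ler_wpM2l ?subr_ge0//.
  have h : (1 - z^-1) * z <= ln z * z by rewrite ler_pM2r// ln_ge_subr1V.
  rewrite mulrBl mul1r mulVf ?gt_eqF// in h.
  by rewrite mulrDr mulr1 (le_trans h)// lerDl ln_ge0.
rewrite ler_wnM2l ?subr_le0//.
have l0 : ln z <= 0 by exact: ln_le0.
rewrite mulrDr mulr1 (le_trans _ (ln_le_subr1 z0))//.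
by rewrite gerDr mulr_le0_ge0// ltW.
Qed.

Lemma jphi_ge0 z : 0 < z -> 0 <= jphi z.
Proof.
move=> z0; have z1 : 0 < z + 1 by lra.
by rewrite -(pmulr_lge0 _ z1) (le_trans _ (jphi_ge z0)) ?sqr_ge0.
Qed.

(** Weighted arithmetic-geometric mean inequality applied to [jphi_ge]. Averaged over [i], it turns
    control of mass and divergence into an L1 bound on [z - 1]. *)
Lemma normr_subr1_le s z : 0 < s -> 0 < z ->
  `|z - 1| <= s * (z + 1) / 4 + jphi z / s.
Proof.
move=> s0 z0; have z1 : 0 < z + 1 by lra.
have h : (z - 1) ^+ 2 / (z + 1) <= jphi z by rewrite ler_pdivrMr// jphi_ge.
have h2 : (z - 1) ^+ 2 / (z + 1) / s <= jphi z / s.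
  by rewrite ler_wpM2r// invr_ge0 ltW.
apply: le_trans (lerD (lexx _) h2).
have s' : s != 0 by rewrite gt_eqF.
have z' : z + 1 != 0 by rewrite gt_eqF.
rewrite -subr_ge0 -[X in X - _]addrC -real_normK ?num_real//.
set a := `|z - 1|.
suff -> : a ^+ 2 / (z + 1) / s + s * (z + 1) / 4 - a =
          (a - s * (z + 1) / 2) ^+ 2 / (z + 1) / s.
  by rewrite divr_ge0 ?(ltW s0)// divr_ge0 ?(ltW z1)// sqr_ge0.
by field; rewrite s' z'.
Qed.

Context (I : finType) (p v : I -> R) (B : R).
Hypotheses (p0 : forall i, 0 <= p i) (p1 : \sum_i p i = 1).
Hypothesis vB : forall i, `|v i| <= B.

(* Mass is corrected by moving the weights on one side of 1 towards 1,
   so that every [jphi (z i)] decreases. *)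
Lemma renormalize (z : I -> R) : (forall i, 0 < z i) ->
  exists z' : I -> R, [/\ forall i, 0 < z' i, \sum_i p i * z' i = 1,
    \sum_i p i * jphi (z' i) <= \sum_i p i * jphi (z i) &
    \sum_i p i * (v i * z i) - B * `|\sum_i p i * z i - 1| <=
    \sum_i p i * (v i * z' i)].
Proof.
move=> z0.
(* [t i] is the fraction of [z i - 1] that is kept. The corrections [(1 - t i) * (z i - 1)] will all
   have one sign, so their total size is the mass error and the value changes by at most [B] times
   that. *)
suff H (t : I -> R) : (forall i, 0 <= t i <= 1) ->
    \sum_i p i * (1 + t i * (z i - 1)) = 1 ->
    \sum_i `|p i * ((1 - t i) * (z i - 1))| = `|\sum_i p i * z i - 1| ->
    exists z' : I -> R, [/\ forall i, 0 < z' i, \sum_i p i * z' i = 1,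
    \sum_i p i * jphi (z' i) <= \sum_i p i * jphi (z i) &
    \sum_i p i * (v i * z i) - B * `|\sum_i p i * z i - 1| <=
    \sum_i p i * (v i * z' i)].
  set e := \sum_i p i * z i - 1 in H *.
  have eE : e = \sum_i p i * (z i - 1).
    rewrite /e -[X in _ - X = _]p1 -sumrB; apply: eq_bigr => i _; ring.
  have [e0|e0|e0] := ltgtP 0 e.
  (* Excess mass: remove the fraction [e / A] of each positive [z i - 1]. It is at most 1 because
     [A] averages the positive parts of numbers with mean [e]. *)
  - pose A := \sum_i p i * Num.max (z i - 1) 0.
    have eA : e <= A.
      rewrite eE; apply: ler_sum => i _.
      by rewrite ler_wpM2l// le_max lexx.
    have A0 : 0 < A by exact: lt_le_trans eA.
    have sE : \sum_i p i * ((e / A) * Num.max (z i - 1) 0) = e.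
      under eq_bigr do rewrite mulrCA.
      by rewrite -mulr_sumr divfK// gt_eqF.
    have eA01 : 0 <= e / A <= 1.
      by rewrite ler_pdivrMr// mul1r eA divr_ge0 1?ltW.
    pose t i := if 1 <= z i then 1 - e / A else 1.
    have tE i : (1 - t i) * (z i - 1) = e / A * Num.max (z i - 1) 0.
      rewrite /t; case: ifPn => [h|].
        by rewrite max_l ?subr_ge0// opprB addrCA subrr addr0.
      by rewrite -ltNge => h; rewrite subrr mul0r max_r ?mulr0// subr_le0 ltW.
    apply: (H t).
    + by move=> i; rewrite /t; case: ifP => _; lra.
    + rewrite -[RHS]p1; transitivity (\sum_i p i * z i - e).
        rewrite -[in RHS]sE -sumrB; apply: eq_bigr => i _; rewrite -tE; ring.
      rewrite p1 /e; ring.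
    + rewrite (gtr0_norm e0) -[RHS]sE; apply: eq_bigr => i _.
      rewrite tE ger0_norm//; apply: mulr_ge0 => //; apply: mulr_ge0; first lra.
      by rewrite le_max lexx orbT.
  - pose A := \sum_i p i * Num.max (1 - z i) 0.
    have eA : - e <= A.
      rewrite eE -sumrN; apply: ler_sum => i _.
      by rewrite -mulrN opprB ler_wpM2l// le_max lexx.
    have A0 : 0 < A by apply: lt_le_trans eA; rewrite oppr_gt0.
    have sE : \sum_i p i * ((- e / A) * Num.max (1 - z i) 0) = - e.
      under eq_bigr do rewrite mulrCA.
      by rewrite -mulr_sumr divfK// gt_eqF.
    have eA01 : 0 <= - e / A <= 1.
      by rewrite ler_pdivrMr// mul1r eA divr_ge0 ?oppr_ge0 1?ltW.
    pose t i := if z i <= 1 then 1 + e / A else 1.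
    have tE i : (1 - t i) * (z i - 1) = - (- e / A * Num.max (1 - z i) 0).
      rewrite /t; case: ifPn => [h|].
        by rewrite max_l ?subr_ge0//; ring.
      by rewrite -ltNge => h; rewrite subrr mul0r max_r ?mulr0 ?oppr0// subr_le0 ltW.
    apply: (H t).
    + by move=> i; rewrite /t; case: ifP => _; lra.
    + rewrite -[RHS]p1; transitivity (\sum_i p i * z i + (- e)).
        rewrite -[in RHS]sE -big_split/=; apply: eq_bigr => i _.
        rewrite (_ : - e / A * _ = - ((1 - t i) * (z i - 1))); first ring.
        by rewrite tE opprK.
      rewrite p1 /e; ring.
    + rewrite (ltr0_norm e0) -[RHS]sE; apply: eq_bigr => i _.
      rewrite tE mulrN normrN ger0_norm//; apply: mulr_ge0 => //.
      by apply: mulr_ge0; [lra|rewrite le_max lexx orbT].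
  - apply: (H (fun=> 1)).
    + by move=> i; rewrite ler01 lexx.
    + under eq_bigr do rewrite mul1r addrC subrK.
      by move: e0; rewrite /e; lra.
    + rewrite -e0 normr0 big1// => i _; by rewrite subrr mul0r mulr0 normr0.
move=> t01 tz te; exists (fun i => 1 + t i * (z i - 1)); split => //.
- move=> i; have /andP[t0 t1] := t01 i; have := z0 i.
  have [z1|/ltW z1] := leP 1 (z i); move=> zi0.
    by rewrite ltr_pwDl// mulr_ge0// subr_ge0.
  have : 0 <= (1 - t i) * (1 - z i) by rewrite mulr_ge0// subr_ge0.
  lra.
- apply: ler_sum => i _; rewrite ler_wpM2l// (le_trans (jphi_contract _ _))//.
  have /andP[t0 t1] := t01 i.
  by rewrite ler_piMl// jphi_ge0.
- rewrite lerBlDr -lerBlDl -te mulr_sumr -sumrB; apply: ler_sum => i _.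
  rewrite (_ : _ - _ = v i * (p i * ((1 - t i) * (z i - 1)))); last ring.
  by rewrite (le_trans (ler_norm _))// normrM ler_wpM2r.
Qed.

End contraction.

(** * Lagrange multipliers *)

Section multiplier.
Context {R : realType} (I : finType) (p v : I -> R) (B : R).
Hypotheses (p0 : forall i, 0 <= p i) (p1 : \sum_i p i = 1).
Hypothesis vB : forall i, `|v i| <= B.

Let mass nu c := \sum_i p i * expR (tilt (nu * v i - c)).

(** At [c = - nu * B] every weight is at least 1 and at [c = nu * B] at most 1; the intermediate
    value theorem applies. *)
Lemma normalizing_shift nu : 0 <= nu ->
  exists c, `|c| <= nu * B /\ mass nu c = 1.
Proof.
move=> nu0.
have B0 : 0 <= B.
  case: (pickP I) => [i _|I0]; first exact: le_trans (vB i).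
  by have := p1; rewrite big_pred0// => /eqP; rewrite eq_sym oner_eq0.
have vnu i : `|nu * v i| <= nu * B by rewrite normrM ger0_norm ?ler_wpM2l.
have nuB : 0 <= nu * B by rewrite mulr_ge0.
have [|||c cB c1] := @IVT R (mass nu) (- (nu * B)) (nu * B) 1.
- lra.
- apply: continuous_subspaceT; apply: continuous_big => [|i _].
    exact: add_continuous.
  move=> c; apply: cvgMr; apply: continuous_comp; last exact: continuous_expR.
  apply: continuous_comp; last exact: tilt_continuous.
  by apply: cvgB; [exact: cvg_cst|exact: cvg_id].
- have h1 : 1 <= mass nu (- (nu * B)).
    rewrite -[leLHS]p1; apply: ler_sum => i _; rewrite ler_peMr//.
    rewrite -[leLHS]expR0 ler_expR -[leLHS]tilt0 tilt_le//.
    by have := vnu i; rewrite ler_norml => /andP[]; lra.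
  have h2 : mass nu (nu * B) <= 1.
    rewrite -[leRHS]p1; apply: ler_sum => i _; rewrite ler_piMr//.
    rewrite -[leRHS]expR0 ler_expR -[leRHS]tilt0 tilt_le//.
    by have := vnu i; rewrite ler_norml => /andP[]; lra.
  by rewrite ge_min le_max h1 h2 orbT.
- by exists c; rewrite ler_norml; move: cB; rewrite in_itv.
Qed.

Let shift (nu : R) : R := xget 0 [set c | `|c| <= nu * B /\ mass nu c = 1].

Let shiftP nu : 0 <= nu -> `|shift nu| <= nu * B /\ mass nu (shift nu) = 1.
Proof.
move=> /normalizing_shift[c hc]; rewrite /shift.
by case: xgetP => // /(_ c)/(_ hc).
Qed.

(** If [shift] grew faster, every argument of [tilt] would strictly decrease and so would the total
    mass, which is 1 on both sides. Hence the choice made by [xget] is continuous. *)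
Let shift_lip nu nu' : 0 <= nu -> 0 <= nu' ->
  `|shift nu - shift nu'| <= B * `|nu - nu'|.
Proof.
suff H x y : 0 <= x -> 0 <= y -> shift x - shift y <= B * `|x - y|.
  by move=> n0 n0'; rewrite ler_norml H// andbT lerNl opprB distrC H.
move=> x0 y0; rewrite leNgt; apply/negP => h.
have [_ mx] := shiftP x0; have [_ my] := shiftP y0.
suff : mass x (shift x) < mass y (shift y) by rewrite mx my ltxx.
have lt_z i : expR (tilt (x * v i - shift x)) < expR (tilt (y * v i - shift y)).
  rewrite ltr_expR tilt_lt//.
  have : (x - y) * v i <= B * `|x - y|.
    by rewrite (le_trans (ler_norm _))// normrM mulrC ler_wpM2r.
  move: h; rewrite mulrBl.
  move: (shift x) (shift y) (B * _) (x * v i) (y * v i) => {mx my} a b c e f.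
  lra.
rewrite lt_def; apply/andP; split; last first.
  apply: ler_sum => i _; apply: ler_wpM2l; first exact: p0.
  exact/ltW/lt_z.
apply/eqP => /eqP; rewrite eq_sym -subr_eq0 -sumrB.
under eq_bigr do rewrite -mulrBr.
rewrite -oppr_eq0 -sumrN.
rewrite psumr_eq0 => [/allP hp|i _]; last first.
  by rewrite -mulrN opprB mulr_ge0// subr_ge0 ltW.
have : \sum_i p i = 0.
  apply: big1 => i _; have := hp i (mem_index_enum i).
  rewrite /= oppr_eq0 mulf_eq0 => /orP[/eqP//|].
  by rewrite subr_eq0 lt_eqF.
by rewrite p1 => /eqP; rewrite oner_eq0.
Qed.

Let cost nu := \sum_i p i * jphi (expR (tilt (nu * v i - shift nu))).

(** [shift] is controlled for nonnegative arguments only; composing with the absolute value gives a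
    function continuous on the whole line. *)
Let cost_continuous : continuous (fun nu : R => cost `|nu|).
Proof.
apply: continuous_big => [|i _]; first exact: add_continuous.
have shift_cont : continuous (fun nu : R => shift `|nu|).
  move=> x; apply/cvgrPdist_le => /= e e0.
  have B0 : 0 <= B by exact: le_trans (vB i).
  have eB : 0 < e / (B + 1) by rewrite divr_gt0// ltr_wpDl.
  near=> y; rewrite (le_trans (shift_lip _ _))//.
  have xy : `|x - y| <= e / (B + 1).
    near: y; apply: (@cvgr_dist_le _ _ _ _ _ id x (@cvg_id _ (nbhs x))); exact: eB.
  have -> : e = (B + 1) * (e / (B + 1)) by rewrite mulrC divfK// gt_eqF// ltr_wpDl.
  apply: ler_pM => //; first by rewrite lerDl.
  exact: le_trans (ler_dist_dist _ _) xy.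
have tilt_cont : continuous (fun nu : R => tilt (`|nu| * v i - shift `|nu|)).
  move=> x; apply: continuous_comp; last exact: tilt_continuous.
  apply: cvgB; last exact: shift_cont.
  by apply: cvgMl; exact: norm_continuous.
move=> x; apply: cvgMr; rewrite /jphi; under eq_fun do rewrite expRK.
rewrite expRK; apply: cvgM; last exact: tilt_cont.
apply: cvgB; last exact: cvg_cst.
by apply: continuous_comp; [exact: tilt_cont|exact: continuous_expR].
Unshelve. all: by end_near. Qed.

(* KKT conditions at [lambda = 1 / nu] and [mu = c / nu]: either the
   multiplier [lambda] takes the least admissible value [1 / nu0], or the
   divergence constraint is active. *)
Lemma kkt_multipliers (tau nu0 : R) : 0 < tau -> 0 < nu0 ->
  exists nu c, let z i := expR (tilt (nu * v i - c)) in
  [/\ 0 < nu <= nu0, `|c| <= nu * B, \sum_i p i * z i = 1,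
      \sum_i p i * jphi (z i) <= tau &
      nu = nu0 \/ \sum_i p i * jphi (z i) = tau].
Proof.
move=> tau0 nu00.
(* Within budget at [nu0], take [nu0]. Otherwise [cost] is 0 at 0, where all weights are 1, and
   exceeds [tau] at [nu0], so it equals [tau] in between. *)
have [h|h] := leP (cost nu0) tau.
  exists nu0, (shift nu0); have [? ?] := shiftP (ltW nu00).
  by split; [rewrite nu00 lexx| | | |left].
have cost0 : cost `|0 : R| = 0.
  rewrite /cost; apply: big1 => i _; have [+ _] := shiftP (lexx 0).
  rewrite mul0r normr_le0 normr0 => /eqP ->.
  by rewrite mul0r subr0 tilt0 expR0 /jphi subrr mul0r mulr0.
have [|||nu nuI nuE] := @IVT R (fun nu => cost `|nu|) 0 nu0 tau.
- exact: ltW.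
- exact: continuous_subspaceT.
- by rewrite cost0 (gtr0_norm nu00) min_l ?max_r ?ltW//; exact: lt_trans h.
move: nuI nuE; rewrite in_itv/= => /andP[nu_ge0 nu_le].
rewrite ger0_norm// => nuE.
exists nu, (shift nu); have [shift_le shift1] := shiftP nu_ge0.
split; [|exact: shift_le|exact: shift1|by rewrite -nuE lexx|right; exact: nuE].
rewrite nu_le andbT lt_def nu_ge0 andbT; apply/eqP => nu0E.
have : tau = 0 by rewrite -nuE nu0E -[X in cost X](@normr0 _ R) cost0.
by move: tau0 => /[swap] ->; rewrite ltxx.
Qed.

End multiplier.

(** * Concentration on a finite space *)

Section bernstein.
Context {R : realType} (I K : finType) (p : I -> R) (f : K -> I -> R).
Context (W rho : R).
Hypotheses (p0 : forall i, 0 <= p i) (p1 : \sum_i p i = 1).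
Hypotheses (W0 : 0 < W) (rho0 : 0 < rho).
Hypothesis f_bounded : forall k i, `|f k i| <= W / rho.
Hypothesis f_moment2 : forall k, \sum_i p i * f k i ^+ 2 <= W.

Let mean k := \sum_i p i * f k i.

(** Chernoff exponent [th = rho / (4 W)]: then [th * f <= 1/4], within reach of [expR_le_quadratic],
    the means cancel, and [- th * rho + 2 th^2 W = - rho^2 / (8 W)] remains. *)
Lemma mgf_le k : \sum_i p i * expR (rho / (4 * W) * (f k i - (mean k + rho))) <=
  expR (- (rho ^+ 2 / (8 * W))).
Proof.
set th := rho / (4 * W).
have th0 : 0 < th by rewrite divr_gt0// mulr_gt0.
have W0' : W != 0 by rewrite gt_eqF.
have rho0' : rho != 0 by rewrite gt_eqF.
have thf i : th * f k i <= 2^-1.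
  rewrite (@le_trans _ _ (th * (W / rho)))//.
    by rewrite ler_wpM2l ?(ltW th0)// (le_trans (ler_norm _)).
  have -> : th * (W / rho) = 4^-1 by rewrite /th; field; rewrite W0' rho0'.
  lra.
rewrite (_ : \sum_i _ =
    (\sum_i p i * expR (th * f k i)) * expR (- (th * (mean k + rho)))); last first.
  rewrite mulr_suml; apply: eq_bigr => i _.
  by rewrite mulrBr expRD mulrA.
have h : \sum_i p i * expR (th * f k i) <= expR (th * mean k + 2 * th ^+ 2 * W).
  apply: le_trans (expR_ge1Dx _).
  have -> : 1 + (th * mean k + 2 * th ^+ 2 * W) =
      \sum_i p i + \sum_i p i * (th * f k i) + 2 * th ^+ 2 * W.
    rewrite p1 addrA /mean mulr_sumr; congr (_ + _ + _).
    by apply: eq_bigr => i _; rewrite mulrCA.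
  rewrite -big_split/= (le_trans _ (lerD (lexx _) (ler_wpM2l _ (f_moment2 k))))//.
    rewrite mulr_sumr -big_split/=; apply: ler_sum => i _.
    have := ler_wpM2l (p0 i) (expR_le_quadratic (thf i)).
    by move=> h; rewrite (le_trans h)//; lra.
  by rewrite mulr_ge0// sqr_ge0.
rewrite (le_trans (ler_wpM2r (expR_ge0 _) h))// -expRD ler_expR.
have -> : 2 * th ^+ 2 * W = th * rho / 2 by rewrite /th; field.
have -> : rho ^+ 2 / (8 * W) = th * rho / 2 by rewrite /th; field.
lra.
Qed.

Lemma finite_bernstein N :
  \sum_(w : {ffun 'I_N -> I} |
      ~~ [forall k, \sum_i f k (w i) <= N%:R * (mean k + rho)])
    \prod_i p (w i) <= #|K|%:R * expR (- (N%:R * (rho ^+ 2 / (8 * W)))).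
Proof.
have pw0 (w : {ffun 'I_N -> I}) : 0 <= \prod_i p (w i) by exact: prodr_ge0.
pose e k (w : {ffun 'I_N -> I}) :=
  expR (rho / (4 * W) * (\sum_i f k (w i) - N%:R * (mean k + rho))).
(* Markov's inequality and a union bound: on a bad [w] some [e k w] is at least 1. Below, the sum
   over [w] factors over the coordinates, which is independence. *)
apply: (@le_trans _ _ (\sum_(w : {ffun 'I_N -> I}) \sum_k
    (\prod_i p (w i)) * e k w)).
  rewrite big_mkcond/=; apply: ler_sum => w _; case: ifPn; last first.
    by move=> _; apply: sumr_ge0 => k _; rewrite mulr_ge0// expR_ge0.
  rewrite negb_forall => /existsP[k]; rewrite -ltNge => hk.
  rewrite (bigD1 k)//= -[leLHS]addr0 lerD//; last first.
    by apply: sumr_ge0 => k' _; rewrite mulr_ge0// expR_ge0.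
  rewrite ler_peMr// /e -[leLHS]expR0 ler_expR mulr_ge0 ?subr_ge0 ?(ltW hk)//.
  by rewrite divr_ge0// ltW// mulr_gt0.
rewrite exchange_big/= -sum1_card natr_sum mulr_suml; apply: ler_sum => k _.
rewrite mul1r.
have -> : \sum_(w : {ffun 'I_N -> I}) (\prod_i p (w i)) * e k w =
    \sum_(w : {ffun 'I_N -> I}) \prod_(i < N)
      (p (w i) * expR (rho / (4 * W) * (f k (w i) - (mean k + rho)))).
  apply: eq_bigr => w _; rewrite big_split/=; congr (_ * _).
  rewrite -expR_sum -mulr_sumr /e sumrB; congr (expR (_ * (_ - _))).
  by rewrite sumr_const card_ord mulr_natl.
rewrite -(bigA_distr_bigA (fun (_ : 'I_N) i =>
   p i * expR (rho / (4 * W) * (f k i - (mean k + rho))))).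
rewrite prodr_const card_ord -mulrN expRM_natl.
apply: lerXn2r; [rewrite nnegrE|by rewrite nnegrE expR_ge0|exact: mgf_le].
by apply: sumr_ge0 => i _; rewrite mulr_ge0 ?expR_ge0.
Qed.

End bernstein.

(** * Jeffreys divergence on a finite partition *)

Section measure_complements.
Local Open Scope ereal_scope.
Local Open Scope charge_scope.
Context d (T : measurableType d) (R : realType).
Implicit Types P Q : probability T R.

(** Positive and negative parts are compared separately. It serves for [lne] of a Radon-Nikodym
    derivative, whose integrability is not known. *)
Lemma ae_le_integral (mu : {measure set T -> \bar R}) (F G : T -> \bar R) :
  measurable_fun setT F -> measurable_fun setT G ->
  {ae mu, forall x, F x <= G x} -> \int[mu]_x F x <= \int[mu]_x G x.
Proof.
move=> mF mG FG; rewrite integralE [leRHS]integralE leeB//.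
  apply: ae_ge0_le_integral => //; [exact: measurable_funepos..|].
  apply: filterS FG => x FGx _.
  by apply: (@funepos_le _ _ [set x]); rewrite ?inE// => y; rewrite inE => ->.
apply: ae_ge0_le_integral => //; [exact: measurable_funeneg..|].
apply: filterS FG => x FGx _.
by apply: (@funeneg_le _ _ [set x]); rewrite ?inE// => y; rewrite inE => ->.
Qed.

Lemma measurable_lne_fin_num (f : T -> \bar R) : measurable_fun setT f ->
  (forall x, f x \is a fin_num) -> measurable_fun setT (@lne R \o f).
Proof.
move=> mf ffin.
have -> : @lne R \o f = fun x => if f x <= 0 then -oo else (ln (fine (f x)))%:E.
  apply/funext => x /=; have := ffin x.
  by case: (f x) => //= r _; rewrite lee_fin.
apply: measurable_fun_ifT; first exact: measurable_fun_lee.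
  exact: measurable_cst.
apply/measurable_EFinP; apply: measurableT_comp; first exact: measurable_ln.
apply: measurableT_comp => //; exact: fine_measurable.
Qed.

End measure_complements.

Section bins.
Context d (T : measurableType d) (R : realType) (I : finType) (g : T -> I).
Hypothesis mg : forall i, measurable (g @^-1` [set i]).
Implicit Types (P Q : probability T R) (h : I -> R).

Lemma measurable_bin d' (U : measurableType d') (h : I -> U) :
  measurable_fun setT (h \o g).
Proof.
move=> _ A mA; rewrite setTI.
have -> : (h \o g) @^-1` A = \bigcup_(i in [set i | A (h i)]) g @^-1` [set i].
  apply/seteqP; split => [x Ax|x [i Ai /= ->//]].
  by exists (g x).
by apply: fin_bigcup_measurable => // i _; exact: mg.
Qed.

Definition binp P i : R := fine (P (g @^-1` [set i])).

Lemma binpE P i : (binp P i)%:E = P (g @^-1` [set i]).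
Proof. by rewrite fineK// fin_num_measure. Qed.

Lemma binp_ge0 P i : 0 <= binp P i.
Proof. by rewrite fine_ge0// measure_ge0. Qed.

Lemma integrable_bin P h : P.-integrable setT (fun x => (h (g x))%:E).
Proof.
apply: (measurable_bounded_integrable (f := h \o g)) => //.
- by rewrite [ltLHS]probability_setT ltry.
- exact: measurable_bin.
exists (\sum_i `|h i|); split; first exact: num_real.
move=> M hM x _ /=; rewrite (le_trans _ (ltW hM))// (bigD1 (g x))//=.
by rewrite lerDl sumr_ge0.
Qed.

Lemma integral_bin_set P h A : measurable A ->
  (\int[P]_(x in A) (h (g x))%:E = \sum_i (h i)%:E * P (A `&` g @^-1` [set i]))%E.
Proof.
move=> mA.
transitivity (\int[P]_(x in A) (\sum_i (h i)%:E * (\1_(g @^-1` [set i]) x)%:E))%E.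
  apply: eq_integral => x _; rewrite (bigD1 (g x))//= big1 ?adde0.
    by rewrite indicE mem_set// mule1.
  move=> i ig; rewrite indicE memNset ?mule0//= => /eqP.
  by rewrite eq_sym (negbTE ig).
have ii i : P.-integrable A (fun x => (\1_(g @^-1` [set i]) x)%:E).
  apply: (integrableS measurableT) => //; exact: integrable_indic.
rewrite integral_sum//; last by move=> i; exact: integrableZl.
apply: eq_bigr => i _; rewrite integralZl// integral_indic// setIC//.
Qed.

Lemma integral_bin P h : (\int[P]_x (h (g x))%:E = (\sum_i binp P i * h i)%:E)%E.
Proof.
rewrite integral_bin_set// -sumEFin; apply: eq_bigr => i _.
by rewrite setTI EFinM binpE muleC.
Qed.

Lemma sum_binp P : \sum_i binp P i = 1.
Proof.
apply: EFin_inj; rewrite -(probability_setT P) -[RHS]mul1e -integral_cst//.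
by rewrite (integral_bin P (fun=> 1)); congr EFin; apply: eq_bigr => i _; rewrite mulr1.
Qed.

End bins.

(** * Lower bounds on the divergence, and weak duality *)

Section kullback_leibler.
Context d (T : measurableType d) (R : realType) (I : finType) (g : T -> I).
Hypothesis mg : forall i, measurable (g @^-1` [set i]).
Implicit Types (P Q : probability T R) (z : I -> R).

(* [a <= e^a - 1] at [a = ln z - ln (dQ/dP)], integrated against [Q]. *)
Lemma KL_ge Q P z : (forall i, 0 < z i) ->
  ((\sum_i binp g Q i * ln (z i) + 1 - \sum_i binp g P i * z i)%:E <= KL Q P)%E.
Proof.
move=> z0; rewrite /KL; case: asboolP => [QP|_]; last exact: leey.
(* A version of the density that is finite and nonnegative everywhere; it agrees with the derivative
   in [KL] almost everywhere for [P], hence for [Q]. *)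
pose f0 := Radon_Nikodym_SigmaFinite.f Q P.
have ff0 := null_dominates_ae_eq measurableT QP
  (ae_eq_Radon_Nikodym_SigmaFinite QP measurableT).
have mf0 : measurable_fun setT f0.
  exact: measurable_int (Radon_Nikodym_SigmaFinite.f_integrable QP).
have f0ge0 := Radon_Nikodym_SigmaFinite.f_ge0 QP.
have f0fin := Radon_Nikodym_SigmaFinite.f_fin_num QP.
(* The inverse density where [f0 > 0]. Where [f0 = 0], [ln 0 = 0] makes it 1, so that [k * f0 <= 1]
   everywhere. *)
pose k x := expR (- ln (fine (f0 x))).
have mk : measurable_fun setT k.
  apply: measurableT_comp; first exact: measurable_expR.
  apply: measurableT_comp; first exact: oppr_measurable.
  apply: measurableT_comp; first exact: measurable_ln.
  by apply: measurableT_comp => //; exact: fine_measurable.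
have mzk : measurable_fun setT (fun x => (z (g x) * k x)%:E).
  apply/measurable_EFinP; apply: measurable_funM => //.
  exact: (measurable_bin mg).
have zk0 x : 0 <= z (g x) * k x by rewrite mulr_ge0 ?expR_ge0 ?(ltW (z0 _)).
have zk_le : (\int[Q]_x (z (g x) * k x)%:E <= (\sum_i binp g P i * z i)%:E)%E.
  rewrite -(integral_bin mg) -(Radon_Nikodym_SigmaFinite.change_of_variables QP)//.
  apply: ge0_le_integral => //.
  - by move=> x _; rewrite mule_ge0 ?lee_fin.
  - exact: emeasurable_funM.
  - exact/measurable_EFinP/(measurable_bin mg).
  move=> x _; have := f0ge0 x; have := f0fin x; rewrite /k -/f0.
  case: (f0 x) => //= r _; rewrite lee_fin le_eqVlt => /orP[/eqP <-|r0].
    by rewrite mule0 lee_fin ltW.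
  by rewrite -EFinM lee_fin -mulrA expRN lnK ?posrE// mulVf ?mulr1// gt_eqF.
have izk : Q.-integrable setT (fun x => (z (g x) * k x)%:E).
  apply/integrableP; split => //.
  under eq_integral do rewrite gee0_abs ?lee_fin//.
  by rewrite (le_lt_trans zk_le)// ltry.
pose G x := ((ln (z (g x)) + 1)%:E - (z (g x) * k x)%:E)%E.
have iln := integrable_bin mg Q (fun i => ln (z i) + 1).
have GE : (\int[Q]_x G x = (\sum_i binp g Q i * (ln (z i) + 1))%:E -
    \int[Q]_x (z (g x) * k x)%:E)%E.
  by rewrite integralB// (integral_bin mg Q (fun i => ln (z i) + 1)).
apply: (@le_trans _ _ (\int[Q]_x G x)%E).
  rewrite GE [leLHS]EFinB leeB// lee_fin.
  by under [leRHS]eq_bigr do rewrite mulrDr mulr1; rewrite big_split/= (sum_binp mg).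
apply: ae_le_integral.
- apply: emeasurable_funB => //.
  exact/measurable_EFinP/(measurable_bin mg (fun i => ln (z i) + 1)).
- apply: measurable_lne_fin_num; first
    by apply: measurable_int; exact: Radon_Nikodym_integrable.
  by move=> x; exact: Radon_Nikodym_fin_num.
(* [Q] of the zero set of [f0] is the integral of [f0] over that set. *)
have f0pos : {ae Q, forall x, (0 < f0 x)%E}.
  exists [set x | (f0 x <= 0)%E]; split.
  - have := emeasurable_fun_infty_c measurableT mf0 0%E; rewrite setTI.
    by apply.
  - rewrite (Radon_Nikodym_SigmaFinite.f_integral QP); last first.
      by have := emeasurable_fun_infty_c measurableT mf0 0%E; rewrite setTI; apply.
    apply: integral0_eq => x /= fx; apply/eqP; rewrite eq_le fx; exact: f0ge0.
  - by move=> x /= /negP; rewrite -leNgt.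
apply: filterS2 ff0 f0pos => x /(_ Logic.I) <-.
have := f0fin x; rewrite /G /k -/f0; case: (f0 x) => // r _.
rewrite lte_fin => r0; rewrite lne_EFin// -EFinB lee_fin.
have h := expR_ge1Dx (ln (z (g x)) - ln r).
rewrite expRD lnK ?posrE// in h.
rewrite /=; lra.
Qed.

(* Weak duality with [lam] the multiplier of the divergence constraint and [mu]
   that of the total mass; [z i - 1 + ln (z i)] is the Legendre transform of
   [jphi] at its slope [ln (z i) + 1 - (z i)^-1]. *)
Lemma jeffreys_weak_duality Q P z (v : I -> R) (tau lam mu : R) :
  0 <= lam -> (forall i, 0 < z i) ->
  (forall i, lam * (ln (z i) + 1 - (z i)^-1) = v i - mu) ->
  (KL Q P + KL P Q <= tau%:E)%E ->
  \sum_i binp g Q i * v i <=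
  lam * tau + mu + \sum_i binp g P i * (lam * (z i - 1 + ln (z i))).
Proof.
move=> lam0 z0 zE KLtau.
have h1 := KL_ge Q P z0.
(* The reverse divergence takes the reciprocal weights, as [dP/dQ] is the inverse of [dQ/dP]. *)
have h2 := @KL_ge P Q (fun i => (z i)^-1) (fun i => etrans (invr_gt0 _) (z0 i)).
have := le_trans (leeD h1 h2) KLtau; rewrite -EFinD lee_fin.
have -> : \sum_i binp g P i * ln (z i)^-1 = - \sum_i binp g P i * ln (z i).
  by rewrite -sumrN; apply: eq_bigr => i _; rewrite lnV ?posrE// mulrN.
move=> h.
have h' := ler_wpM2l lam0 h.
have : \sum_i binp g Q i * v i = mu +
    (lam * (\sum_i binp g Q i * ln (z i)) + lam - lam * \sum_i binp g Q i / z i).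
  transitivity (mu * \sum_i binp g Q i + (lam * (\sum_i binp g Q i * ln (z i))
     + lam * (\sum_i binp g Q i) - lam * \sum_i binp g Q i / z i)); last first.
    by rewrite (sum_binp mg) !mulr1.
  rewrite !mulr_sumr -sumrN -!big_split/=; apply: eq_bigr => i _.
  rewrite -[v i](subrK mu) -zE; ring.
have : \sum_i binp g P i * (lam * (z i - 1 + ln (z i))) =
    lam * (\sum_i binp g P i * z i) - lam + lam * (\sum_i binp g P i * ln (z i)).
  transitivity (lam * (\sum_i binp g P i * z i) - lam * (\sum_i binp g P i)
     + lam * (\sum_i binp g P i * ln (z i))); last first.
    by rewrite (sum_binp mg) !mulr1.
  rewrite !mulr_sumr -sumrN -!big_split/=; apply: eq_bigr => i _; ring.
move=> -> ->; lra.
Qed.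

End kullback_leibler.

(** * Probability measures with density constant on bins *)

Section reweighting.
Context d (T : measurableType d) (R : realType) (I : finType) (g : T -> I).
Context (P : probability T R) (z : I -> R).
Local Open Scope ereal_scope.

(* The proofs are arguments so that the probability structure of [reweight]
   can be inferred from its carrier. *)
Definition reweight (mg : forall i, measurable (g @^-1` [set i]))
    (z0 : forall i, (0 < z i)%R) (z1 : (\sum_i binp g P i * z i = 1)%R) :
    set T -> \bar R :=
  fun A => \int[P]_(x in A) (z (g x))%:E.

Hypothesis mg : forall i, measurable (g @^-1` [set i]).
Hypotheses (z0 : forall i, (0 < z i)%R).
Hypotheses (z1 : (\sum_i binp g P i * z i = 1)%R).
Local Notation Q := (reweight mg z0 z1).

Let reweight0 : Q set0 = 0.
Proof. by rewrite /reweight integral_set0. Qed.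

Let reweight_ge0 A : 0 <= Q A.
Proof. by apply: integral_ge0 => x _; rewrite lee_fin ltW. Qed.

Let reweight_sigma_additive : semi_sigma_additive Q.
Proof.
apply: semi_sigma_additive_nng_induced; last by move=> x; rewrite lee_fin ltW.
exact/measurable_EFinP/(measurable_bin mg).
Qed.

HB.instance Definition _ :=
  isMeasure.Build _ _ _ Q reweight0 reweight_ge0 reweight_sigma_additive.

Let reweight_setT : Q setT = 1.
Proof. by rewrite /reweight integral_bin// z1. Qed.

HB.instance Definition _ := @Measure_isProbability.Build _ _ R Q reweight_setT.

Lemma reweight_bin A i : measurable A ->
  Q (A `&` g @^-1` [set i]) = (z i)%:E * P (A `&` g @^-1` [set i]).
Proof.
move=> mA; rewrite /reweight -integral_cst//; last exact: measurableI.
by apply: eq_integral => x /set_mem[_ /= ->].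
Qed.

Lemma binp_reweight i : binp g Q i = (z i * binp g P i)%R.
Proof.
apply: EFin_inj; rewrite EFinM !binpE//.
by have := reweight_bin i (@measurableT _ T); rewrite !setTI.
Qed.

(** Positive weights can be inverted, so [KL_density] also evaluates the reverse divergence. *)
Lemma reweightV A : measurable A -> P A = \int[Q]_(x in A) ((z (g x))^-1)%:E.
Proof.
move=> mA; rewrite (integral_bin_set mg Q (fun i => (z i)^-1)%R mA).
have -> : P A = \int[P]_(x in A) (cst 1 x).
  by rewrite integral_cst// mul1e.
rewrite (integral_bin_set mg P (fun=> 1%R) mA); apply: eq_bigr => i _.
transitivity (((z i)^-1)%:E * ((z i)%:E * P (A `&` g @^-1` [set i]))).
  by rewrite muleA -EFinM mulVf// gt_eqF.
by congr (_ * _); exact/esym/reweight_bin.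
Qed.

End reweighting.

Section jeffreys_primal.
Context d (T : measurableType d) (R : realType) (I : finType) (g : T -> I).
Hypothesis mg : forall i, measurable (g @^-1` [set i]).
Implicit Types P Q : probability T R.
Local Open Scope ereal_scope.

Lemma density_dominates Q P (z : I -> R) :
  (forall A, measurable A -> Q A = \int[P]_(x in A) (z (g x))%:E) -> Q `<< P.
Proof.
move=> QE; apply/null_content_dominatesP => A mA PA0.
rewrite QE//; apply: null_set_integral => //.
exact/measurable_funTS/measurable_EFinP/(measurable_bin mg).
Qed.

(** Densities are unique [P]-almost everywhere, hence [Q]-almost everywhere by domination. *)
Lemma KL_density Q P (z : I -> R) : (forall i, (0 < z i)%R) ->
  (forall A, measurable A -> Q A = \int[P]_(x in A) (z (g x))%:E) ->
  KL Q P = (\sum_i binp g Q i * ln (z i))%:E.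
Proof.
move=> z0 QE; have QP := density_dominates QE.
rewrite /KL asboolT// -(integral_bin mg Q (fun i => ln (z i))).
apply: ae_eq_integral => //.
- apply: measurable_lne_fin_num; first
    by apply: measurable_int; exact: Radon_Nikodym_integrable.
  by move=> x; exact: Radon_Nikodym_fin_num.
- exact/measurable_EFinP/(measurable_bin mg (fun i => ln (z i))).
apply: (null_dominates_ae_eq measurableT QP).
have mz : measurable_fun setT (fun x => (z (g x))%:E).
  exact/measurable_EFinP/(measurable_bin mg).
have iRN : P.-integrable setT (Radon_Nikodym (charge_of_finite_measure Q) P).
  exact: Radon_Nikodym_integrable.
have [|N [mN N0 sN]] := integral_ae_eq measurableT iRN mz.
  by move=> E _ mE; rewrite -Radon_Nikodym_integral// -QE.
exists N; split => // x /= nx; apply: sN => /= h.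
by apply: nx => _; rewrite h// lne_EFin.
Qed.

(** [reweight] is feasible: its two divergences are the sums of [p z ln z] and of [- p ln z], which
    add up to the mean of [jphi z]. *)
Lemma jeffreys_risk_ge P (X : T -> R) (v z : I -> R) (eta tau : R) :
  measurable_fun setT X -> (forall x, v (g x) - eta <= X x)%R ->
  (forall i, (0 < z i)%R) -> (\sum_i binp g P i * z i = 1)%R ->
  (\sum_i binp g P i * jphi (z i) <= tau)%R ->
  (\sum_i binp g P i * (v i * z i) - eta)%:E <= jeffreys_risk P tau X.
Proof.
move=> mX vX z0 z1 ztau.
pose Q : probability T R := reweight mg z0 z1.
have QP : KL Q P = (\sum_i binp g Q i * ln (z i))%:E by exact: KL_density.
have PQ : KL P Q = (\sum_i binp g P i * ln (z i)^-1)%:E.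
  apply: KL_density; first by move=> i; rewrite invr_gt0.
  exact: reweightV.
apply: (@le_trans _ _ ('E_Q[X])).
  rewrite [in leRHS]unlock.
  have -> : (\sum_i binp g P i * (v i * z i) - eta)%:E =
      \int[Q]_x (v (g x) - eta)%:E.
    rewrite (integral_bin mg Q (fun i => v i - eta)%R); congr EFin.
    under [RHS]eq_bigr do rewrite mulrBr; rewrite sumrB -mulr_suml (sum_binp mg).
    rewrite mul1r; congr (_ - _)%R; apply: eq_bigr => i _.
    by rewrite binp_reweight; ring.
  apply: ae_le_integral => //.
  - exact/measurable_EFinP/(measurable_bin mg (fun i => v i - eta)%R).
  - exact/measurable_EFinP.
  - by apply: nearW => x; rewrite lee_fin.
apply: ereal_sup_ubound; exists Q => //=; split.
  by apply: (@density_dominates _ _ z).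
rewrite QP PQ -EFinD lee_fin (le_trans _ ztau)//.
rewrite -big_split/= le_eqVlt; apply/orP; left; apply/eqP.
apply: eq_bigr => i _; rewrite binp_reweight lnV ?posrE// /jphi; ring.
Qed.

(** The slope equation does not involve [P], so multipliers found for the true measure also bound
    the empirical risk. *)
Lemma jeffreys_risk_le P (X : T -> R) (v z : I -> R) (eta tau lam mu : R) :
  measurable_fun setT X -> (forall x, X x <= v (g x) + eta)%R ->
  (0 <= lam)%R -> (forall i, (0 < z i)%R) ->
  (forall i, lam * (ln (z i) + 1 - (z i)^-1) = v i - mu)%R ->
  jeffreys_risk P tau X <=
  (lam * tau + mu + \sum_i binp g P i * (lam * (z i - 1 + ln (z i))) + eta)%:E.
Proof.
move=> mX vX lam0 z0 zE; apply: ge_ereal_sup => _ [Q [_ KLtau] <-].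
apply: (@le_trans _ _ (\sum_i binp g Q i * v i + eta)%:E); last first.
  by rewrite lee_fin lerD2r (jeffreys_weak_duality mg lam0 z0 zE).
have -> : (\sum_i binp g Q i * v i + eta)%:E = \int[Q]_x (v (g x) + eta)%:E.
  rewrite (integral_bin mg Q (fun i => v i + eta)%R); congr EFin.
  under [RHS]eq_bigr do rewrite mulrDr.
  by rewrite big_split/= -mulr_suml (sum_binp mg) mul1r.
rewrite [in leLHS]unlock; apply: ae_le_integral => //.
- exact/measurable_EFinP.
- exact/measurable_EFinP/(measurable_bin mg (fun i => v i + eta)%R).
- by apply: nearW => x; rewrite lee_fin.
Qed.

End jeffreys_primal.

(** * Empirical measures *)

Section sampling.
Context d (T : measurableType d) (R : realType) (I : finType) (g : T -> I).
Hypothesis mg : forall i, measurable (g @^-1` [set i]).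

Lemma sum_binp_empirical n (x : 'I_n.+1 -> T) (h : I -> R) :
  \sum_i binp g (empirical R x) i * h i = n.+1%:R^-1 * \sum_k h (g (x k)).
Proof.
have bE i : binp g (empirical R x) i =
    n.+1%:R^-1 * \sum_(k < n.+1) (g (x k) == i)%:R.
  apply: EFin_inj; rewrite binpE// [LHS]empiricalE EFinM -sumEFin.
  congr (_ * _)%E; apply: eq_bigr => k _; rewrite diracE.
  by congr ((nat_of_bool _)%:R%:E); apply/idP/eqP => [/set_mem|gk]; last exact/mem_set.
under eq_bigr do rewrite bE -mulrA mulr_suml.
rewrite -mulr_sumr exchange_big/=; congr (_ * _); apply: eq_bigr => k _.
rewrite (bigD1 (g (x k)))//= eqxx mul1r big1 ?addr0// => i ig.
by rewrite eq_sym (negbTE ig) mul0r.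
Qed.

Context (P : probability T R) d' (S : measurableType d') (Pr : probability S R).
Context (J : finType) (xi : J -> {RV Pr >-> T}).
Hypothesis iid_xi : iid P xi.

Let sample (s : S) : {ffun J -> I} := [ffun j => g (xi j s)].

Let sample_fiber w :
  sample @^-1` [set w] =
  \bigcap_(j in [set` [set: J]%SET]) (xi j @^-1` (g @^-1` [set w j])).
Proof.
apply/seteqP; split => [s /= <- j _|s /= h]; first by rewrite /= ffunE.
by apply/ffunP => j; rewrite ffunE; apply: h; rewrite /= inE.
Qed.

Let measurable_sample w : measurable (sample @^-1` [set w]).
Proof.
rewrite sample_fiber; apply: fin_bigcap_measurable => // j _.
by rewrite -[X in measurable X]setTI; exact: measurable_funPT.
Qed.

(** The label vector [sample] is itself a map with measurable fibers into a finite type, so the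
    lemmas on bins apply to it under [Pr]; independence factors its point masses. *)
Lemma iid_with_prob_ge (G : pred {ffun J -> I}) (delta : R) :
  \sum_(w | ~~ G w) \prod_j binp g P (w j) <= delta ->
  with_prob_ge Pr (1 - delta)%:E [set s | G [ffun j => g (xi j s)]].
Proof.
move=> Gdelta.
have mG : measurable [set s | G (sample s)].
  rewrite -[X in measurable X]setTI.
  exact: (measurable_bin measurable_sample G measurableT (Y := [set true])).
have binpw w : binp sample Pr w = \prod_j binp g P (w j).
  apply: EFin_inj; rewrite binpE// sample_fiber.
  case: iid_xi => indep distr; rewrite (indep _ (fun j => g @^-1` [set w j]))//.
  rewrite -prodEFin; apply: eq_big => [j|j _]; first by rewrite inE.
  by rewrite binpE// -(distr j).
rewrite with_prob_geE//.
have -> : Pr [set s | G (sample s)] = (\sum_w binp sample Pr w * (G w)%:R)%:E.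
  rewrite -(integral_bin measurable_sample Pr (fun w => (G w)%:R)).
  rewrite -[X in Pr X]setIT -integral_indic//; apply: eq_integral => s _.
  rewrite indicE; congr ((nat_of_bool _)%:R%:E).
  by apply/idP/idP => [/set_mem|h]//; exact/mem_set.
rewrite lee_fin lerBlDr -[leLHS](sum_binp measurable_sample Pr) -lerBlDl -sumrB.
rewrite (le_trans _ Gdelta)// [leRHS]big_mkcond/=; apply: ler_sum => w _.
by rewrite -binpw; case: (G w); rewrite /= ?mulr1 ?mulr0 ?subrr ?subr0.
Qed.

End sampling.

Lemma discretize d (T : measurableType d) (R : realType) (X : T -> R) (B eta : R) :
  0 <= B -> 0 < eta -> measurable_fun setT X -> (forall x, - B <= X x <= B) ->
  exists m (g : T -> 'I_m.+1) (v : 'I_m.+1 -> R),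
    [/\ forall i, measurable (g @^-1` [set i]), forall i, `|v i| <= B &
        forall x, v (g x) <= X x <= v (g x) + eta].
Proof.
move=> B0 eta0 mX XB.
have pos x : 0 <= (X x + B) / eta.
  by rewrite divr_ge0 ?(ltW eta0)//; have := XB x; lra.
pose m := Num.truncn (2 * B / eta).
pose t x := Num.truncn ((X x + B) / eta).
have tm x : (t x < m.+1)%N.
  rewrite ltnS le_truncn// ler_pM2r ?invr_gt0//; have := XB x; lra.
have tx x : - B + (t x)%:R * eta <= X x <= - B + (t x)%:R * eta + eta.
  have := truncn_itv (pos x); rewrite -/(t x) ler_pdivlMr// ltr_pdivrMr// -natr1.
  by move=> /andP[]; rewrite mulrDl mul1r; lra.
(* Round down to the grid of step [eta] from [- B]. At a label that occurs, the grid point is below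
   [X x <= B], so the cap leaves it unchanged. *)
exists m, (fun x => inord (t x)), (fun i => Num.min B (- B + i%:R * eta)).
split.
- move=> i.
  have -> : (fun x => inord (t x) : 'I_m.+1) @^-1` [set i] =
      X @^-1` [set` `[(- B + i%:R * eta), (- B + i.+1%:R * eta)[].
    have itv x : (X x \in `[(- B + i%:R * eta), (- B + i.+1%:R * eta)[) =
        (i%:R <= (X x + B) / eta < i.+1%:R).
      rewrite in_itv/= ler_pdivlMr// ltr_pdivrMr//.
      by congr (_ && _); apply/idP/idP; lra.
    apply/seteqP; split => x.
      move=> ti; have : X x \in `[(- B + i%:R * eta), (- B + i.+1%:R * eta)[.
        by rewrite itv -ti inordK//; exact: truncn_itv.
      by [].
    move=> h; have {}h : X x \in _ := h; rewrite itv in h.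
    apply: val_inj; rewrite /= inordK//.
    exact: truncn_def.
  rewrite -[X in measurable X]setTI; exact: mX.
- move=> i; rewrite ler_norml le_min ge_min lexx/= andbT.
  by have := mulr_ge0 (ler0n R i) (ltW eta0); move=> h; apply/andP; split; lra.
- move=> x; rewrite inordK//; have /andP[h1 h2] := tx x; have /andP[h3 h4] := XB x.
  by rewrite min_r; [rewrite h1|lra].
Qed.

(** * Sample complexity *)

(** Contracting [z - 1] by [1 - a] with [a = rho / s] absorbs the excess divergence [rho * s]. The
    value drops by at most [a * B * (3 s) = 3 rho B], and renormalizing costs another [rho * B]. *)
Lemma transfer_weights (R : realType) (I : finType) (q v z : I -> R)
    (B rho s tau : R) :
  (forall i, 0 <= q i) -> \sum_i q i = 1 -> (forall i, `|v i| <= B) ->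
  (forall i, 0 < z i) -> 0 < tau -> 0 < rho <= 1 -> s = Num.max (Num.sqrt tau) rho ->
  `|\sum_i q i * z i - 1| <= rho ->
  \sum_i q i * jphi (z i) <= tau + rho * s ->
  exists z' : I -> R, [/\ forall i, 0 < z' i, \sum_i q i * z' i = 1,
    \sum_i q i * jphi (z' i) <= tau &
    \sum_i q i * (v i * z i) - 4 * rho * B <= \sum_i q i * (v i * z' i)].
Proof.
move=> q0 q1 vB z0 tau0 /andP[rho0 rho1] sE qz qphi.
have B0 : 0 <= B.
  case: (pickP I) => [i _|I0]; first exact: le_trans (vB i).
  by have := q1; rewrite big_pred0// => /eqP; rewrite eq_sym oner_eq0.
have s_rho : rho <= s by rewrite sE le_max lexx orbT.
have s0 : 0 < s by exact: lt_le_trans s_rho.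
have tau_s2 : tau <= s ^+ 2.
  rewrite -[leLHS]sqr_sqrtr ?(ltW tau0)// ler_pXn2r ?nnegrE ?sqrtr_ge0 ?(ltW s0)//.
  by rewrite sE le_max lexx.
pose a := rho / s.
have a0 : 0 < a by rewrite divr_gt0.
have a1 : a <= 1 by rewrite ler_pdivrMr// mul1r.
have as_rho : a * s = rho by rewrite divfK// gt_eqF.
pose z1 i := 1 + (1 - a) * (z i - 1).
have z10 i : 0 < z1 i.
  have -> : z1 i = a + (1 - a) * z i by rewrite /z1; ring.
  by rewrite ltr_pwDl// mulr_ge0 ?subr_ge0// ltW.
have phi1 : \sum_i q i * jphi (z1 i) <= tau.
  apply: (@le_trans _ _ ((1 - a) * (tau + rho * s))).
    apply: le_trans (ler_wpM2l _ qphi); last by rewrite subr_ge0.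
    rewrite mulr_sumr; apply: ler_sum => i _; rewrite [leRHS]mulrCA ler_wpM2l//.
    by apply: jphi_contract => //; rewrite subr_ge0 a1 gerBl ltW.
  (* If [s = rho] then [a = 1] and the contracted weights are all 1. Otherwise [s^2 = tau] and the
     bound is [(1 - a^2) * tau]. *)
  have [sr|sr] := eqVneq s rho.
    by rewrite /a sr divff ?gt_eqF// subrr mul0r ltW.
  have ssq : s ^+ 2 = tau.
    rewrite sE; case: (leP (Num.sqrt tau) rho) => h; last by rewrite sqr_sqrtr ?ltW.
    by move: sr; rewrite sE max_r// eqxx.
  have -> : rho * s = a * tau by rewrite -as_rho -ssq; ring.
  have : 0 <= a ^+ 2 * tau by rewrite mulr_ge0 ?sqr_ge0 ?ltW.
  lra.
have [z' [z'0 z'1 phi' val']] := renormalize q0 q1 vB z10.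
exists z'; split => //; first exact: le_trans phi1.
apply: le_trans val'.
have mass1 : `|\sum_i q i * z1 i - 1| <= rho.
  have -> : \sum_i q i * z1 i - 1 = (1 - a) * (\sum_i q i * z i - 1).
    rewrite -[X in _ - X = _]q1 -[X in _ * (_ - X)]q1 -!sumrB mulr_sumr.
    by apply: eq_bigr => i _; rewrite /z1; ring.
  rewrite normrM ger0_norm ?subr_ge0// (le_trans _ qz)// ler_piMl//.
  by rewrite gerBl ltW.
(* By [normr_subr1_le] at scale [s]: the mass term gives at most [3 s / 4], the divergence term at
   most [2 s]. *)
have dist : \sum_i q i * `|z i - 1| <= 3 * s.
  apply: (@le_trans _ _ (s * (\sum_i q i * z i + 1) / 4 +
      (\sum_i q i * jphi (z i)) / s)).
    rewrite -[X in _ * (_ + X)]q1 -big_split/= mulr_sumr !mulr_suml -big_split/=.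
    apply: ler_sum => i _.
    have := ler_wpM2l (q0 i) (normr_subr1_le s0 (z0 i)); move/le_trans; apply.
    rewrite le_eqVlt; apply/orP; left; apply/eqP; ring.
  have h1 : (\sum_i q i * jphi (z i)) / s <= 2 * s.
    rewrite ler_pdivrMr// (le_trans qphi)//.
    have : rho * s <= s * s by rewrite ler_wpM2r// ltW.
    by move: tau_s2; rewrite expr2; lra.
  have h2 : s * (\sum_i q i * z i + 1) <= s * 3.
    by rewrite ler_wpM2l ?(ltW s0)//; move: qz; rewrite ler_norml => /andP[]; lra.
  lra.
have loss : \sum_i q i * (v i * z i) - \sum_i q i * (v i * z1 i) <= 3 * rho * B.
  rewrite -sumrB; apply: (@le_trans _ _ (a * B * (\sum_i q i * `|z i - 1|))).
    rewrite mulr_sumr; apply: ler_sum => i _.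
    have -> : q i * (v i * z i) - q i * (v i * z1 i) = q i * a * (v i * (z i - 1)).
      by rewrite /z1; ring.
    have -> : a * B * (q i * `|z i - 1|) = q i * a * (B * `|z i - 1|) by ring.
    apply: ler_wpM2l; first by rewrite mulr_ge0 ?(ltW a0).
    by rewrite (le_trans (ler_norm _))// normrM ler_wpM2r.
  apply: le_trans (ler_wpM2l _ dist) _; first by rewrite mulr_ge0// ltW.
  by rewrite -as_rho; lra.
have := ler_wpM2l B0 mass1; lra.
Qed.

Section tilted_weights.
Context {R : realType}.
Implicit Types u kappa : R.

Lemma expR_tilt_le u kappa : `|u| <= kappa -> expR (tilt u) <= expR kappa.
Proof.
move=> uk; rewrite ler_expR (le_trans (ler_norm _))//.
exact: le_trans (normr_tilt u) uk.
Qed.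

Lemma jphi_expR_tilt_le u kappa : `|u| <= kappa ->
  jphi (expR (tilt u)) <= kappa * expR kappa.
Proof.
move=> uk; have yk := le_trans (normr_tilt u) uk.
rewrite /jphi expRK mulrC (le_trans (ler_norm _))// normrM ler_pM//.
have y := expR_tilt_le uk.
have z0 : 0 < expR (tilt u) by exact: expR_gt0.
have k1 : 1 <= expR kappa by rewrite -[leLHS]expR0 ler_expR (le_trans _ uk).
by rewrite ler_norml; apply/andP; split; lra.
Qed.

(** With [z = expR (tilt u)], both [|z - 1| <= z |u|] and [|ln z| <= |u|]. The bound is linear in
    [z], whose mean is 1. *)
Lemma conjugate_tilt_le lam u b : 0 <= lam -> lam * `|u| <= b ->
  `|lam * (expR (tilt u) - 1 + tilt u)| <= b * (expR (tilt u) + 1).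
Proof.
move=> lam0 lamu; rewrite normrM ger0_norm//.
have h1 : `|expR (tilt u) - 1| <= expR (tilt u) * `|u|.
  have -> : expR (tilt u) - 1 = expR (tilt u) * (1 - expR (- tilt u)).
    by rewrite mulrBr mulr1 expRxMexpNx_1.
  by rewrite normrM gtr0_norm ?expR_gt0// ler_wpM2l ?expR_ge0 ?normr_subr1_expRN_tilt.
apply: le_trans (_ : lam * (expR (tilt u) * `|u| + `|u|) <= _).
  by rewrite ler_wpM2l// (le_trans (ler_normD _ _))// lerD// normr_tilt.
have -> : lam * (expR (tilt u) * `|u| + `|u|) = lam * `|u| * (expR (tilt u) + 1).
  ring.
by rewrite ler_wpM2r// addr_ge0 ?expR_ge0.
Qed.

End tilted_weights.

(** Bounding [f^2] by [b * a] costs one supremum and one mean instead of two suprema; this keeps the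
    exponential in the sample size to the first power. *)
Lemma moment2_le (R : realType) (I : finType) (p f a : I -> R) (b c : R) :
  (forall i, 0 <= p i) -> 0 <= b ->
  (forall i, `|f i| <= a i) -> (forall i, a i <= b) ->
  \sum_i p i * a i <= c -> \sum_i p i * f i ^+ 2 <= b * c.
Proof.
move=> p0 b0 fa ab pac; apply: le_trans (ler_wpM2l b0 pac).
rewrite mulr_sumr; apply: ler_sum => i _; rewrite [leRHS]mulrCA ler_wpM2l//.
rewrite -real_normK ?num_real// expr2 ler_pM// (le_trans (fa i))//.
Qed.

(** As [epsilon <= B], [h] dominates [expR kappa], so [kappa] and [ln delta^-1] are at most
    [Lambda]. With [ln 5 <= 4] and [1 + kappa <= 2 Lambda], it suffices that
    [N >= 5 * 8 * 16^2 * 2 * Lambda^2 * h], which explains [C]. *)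
Lemma sample_size_bound (R : realType) (tau B epsilon delta : R) (N : R) :
  0 < tau -> 0 < B -> 0 < epsilon <= B -> 0 < delta < 1 ->
  let h := B ^+ 2 * expR (4 * tau * B / epsilon) / epsilon ^+ 2 in
  let Lambda :=
    ln (expR 1 + h + B + B^-1 + epsilon^-1 + tau + tau^-1 + delta^-1) in
  let kappa := 4 * tau * B / epsilon in
  let C := 5 * 16 ^+ 3 in C * Lambda `^ C * h <= N ->
  5 * expR (- (N * ((epsilon / (16 * B)) ^+ 2 / (8 * ((1 + kappa) * expR kappa)))))
    <= delta.
Proof.
move=> tau0 B0 /andP[e0 eB] /andP[d0 d1] h Lambda kappa C hN.
have k0 : 0 < kappa by rewrite divr_gt0// !mulr_gt0.
have h_ge : expR kappa <= h.
  rewrite /h -/kappa mulrAC ler_peMl ?expR_ge0// ler_pdivlMr ?exprn_gt0// mul1r.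
  by rewrite ler_pXn2r// nnegrE ltW.
have h0 : 0 < h by apply: lt_le_trans h_ge; exact: expR_gt0.
set X := expR 1 + h + B + B^-1 + epsilon^-1 + tau + tau^-1 + delta^-1 in Lambda hN *.
have Bi : 0 < B^-1 by rewrite invr_gt0.
have ei : 0 < epsilon^-1 by rewrite invr_gt0.
have ti : 0 < tau^-1 by rewrite invr_gt0.
have di : 0 < delta^-1 by rewrite invr_gt0.
have E0 := expR_gt0 (1 : R).
have X0 : 0 < X by rewrite /X !addr_gt0.
have L1 : 1 <= Lambda.
  by rewrite -[leLHS]expRK ler_ln ?posrE ?expR_gt0// /X; lra.
have Lk : kappa <= Lambda.
  rewrite -[leLHS]expRK ler_ln ?posrE ?expR_gt0// (le_trans h_ge)// /X; lra.
have Ld : ln delta^-1 <= Lambda.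
  by rewrite ler_ln ?posrE// /X; lra.
have C2 : 2 <= C by rewrite /C; lra.
(* [Lambda >= 1], so its exponent can be lowered from [C] to 2. *)
have N_ge : C * Lambda ^+ 2 * h <= N.
  apply: le_trans hN; rewrite ler_wpM2r ?(ltW h0)// ler_wpM2l ?(le_trans _ C2)//.
  by rewrite -powR_mulrn ?(le_trans ler01 L1)// ler_powR.
have ln5 : ln (5 : R) <= 4 by have := @ln_le_subr1 R 5; lra.
have -> : 5 * expR (- (N * ((epsilon / (16 * B)) ^+ 2 /
    (8 * ((1 + kappa) * expR kappa))))) =
  expR (ln 5 - (N * ((epsilon / (16 * B)) ^+ 2 / (8 * ((1 + kappa) * expR kappa))))).
  by rewrite expRD lnK// posrE.
rewrite -[leRHS]lnK ?posrE// ler_expR -[leRHS]opprK -lnV ?posrE// lerBlDr.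
rewrite -lerBlDl opprK.
have k1 : 0 < 1 + kappa by lra.
have M0 := expR_gt0 kappa.
apply: (@le_trans _ _ (5 * Lambda)); first lra.
have -> : (epsilon / (16 * B)) ^+ 2 / (8 * ((1 + kappa) * expR kappa)) =
    (8 * 16 ^+ 2 * (1 + kappa) * h)^-1.
  rewrite /h -/kappa; field.
  by rewrite !gt_eqF.
rewrite ler_pdivlMr; last by do 2![apply: mulr_gt0 => //]; rewrite mulr_gt0.
apply: le_trans N_ge.
rewrite (_ : 5 * Lambda * _ = 5 * 8 * 16 ^+ 2 * (Lambda * (1 + kappa)) * h); last ring.
rewrite ler_wpM2r ?(ltW h0)//.
have : Lambda * (1 + kappa) <= Lambda * (2 * Lambda).
  by rewrite ler_wpM2l; lra.
rewrite /C expr2 => H; lra.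
Qed.

Section statistics.
Context {R : realType} (I : finType) (v z : I -> R) (lam B s : R).

(** Mass from above and from below, value, dual objective and divergence. The concentration bound is
    one-sided, hence the signs; the scalings give all five a common variance bound and the same
    deviation [rho]. *)
Definition statistic (k : 'I_5) (i : I) : R :=
  nth 0 [:: z i; - z i; - (v i * z i) / B;
    lam * (z i - 1 + ln (z i)) / (4 * B); jphi (z i) / s] k.

Context (p u : I -> R) (tau rho kappa : R).
Hypotheses (p0 : forall i, 0 <= p i) (p1 : \sum_i p i = 1).
Hypotheses (vB : forall i, `|v i| <= B) (zE : forall i, z i = expR (tilt (u i))).
Hypotheses (B0 : 0 < B) (lam0 : 0 <= lam) (tau0 : 0 < tau).
Hypotheses (rho01 : 0 < rho <= 1) (sE : s = Num.max (Num.sqrt tau) rho).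
Hypotheses (u_kappa : forall i, `|u i| <= kappa).
Hypotheses (u_lam : forall i, lam * `|u i| <= 2 * B) (kappa0 : 0 <= kappa).
Hypotheses (mass1 : \sum_i p i * z i = 1).
Hypothesis cost_tau : \sum_i p i * jphi (z i) <= tau.

Lemma statistic_bounds k :
  (forall i, `|statistic k i| <= (1 + kappa) * expR kappa / rho) /\
  \sum_i p i * statistic k i ^+ 2 <= (1 + kappa) * expR kappa.
Proof.
have /andP[rho0 rho1] := rho01.
set M := expR kappa; set W := (1 + kappa) * M.
have M1 : 1 <= M by rewrite -[leLHS]expR0 ler_expR.
have M0 : 0 < M by exact: expR_gt0.
have kM0 : 0 <= kappa * M by rewrite mulr_ge0// ltW.
have MW : M <= W by rewrite /W; lra.
have W0 : 0 < W by exact: lt_le_trans MW.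
have WWr : W <= W / rho by rewrite ler_pdivlMr// ler_piMr// ltW.
have z0 i : 0 < z i by rewrite zE expR_gt0.
have zM i : z i <= M by rewrite zE; exact: expR_tilt_le.
have bounds (f a : I -> R) : (forall i, `|f i| <= a i) -> (forall i, a i <= M) ->
    \sum_i p i * a i <= 1 ->
    (forall i, `|f i| <= W / rho) /\ \sum_i p i * f i ^+ 2 <= W.
  move=> fa aM pa; split=> [i|].
    by rewrite (le_trans (fa i))// (le_trans (aM i))// (le_trans MW).
  by rewrite (le_trans (moment2_le p0 (ltW M0) fa aM pa))// mulr1.
have B4 : 0 < 4 * B by rewrite mulr_gt0.
case: k => -[|[|[|[|[|//]]]]] k5; rewrite /statistic/=.
- by apply: (bounds _ z) => //; [move=> i; rewrite gtr0_norm|rewrite mass1].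
- by apply: (bounds _ z) => //; [move=> i; rewrite normrN gtr0_norm|rewrite mass1].
- apply: (bounds _ z) => //; last by rewrite mass1.
  move=> i; rewrite normrM normrN normrM normfV (gtr0_norm B0) (gtr0_norm (z0 i)).
  by rewrite ler_pdivrMr// mulrC ler_wpM2l// ltW.
- apply: (bounds _ (fun i => (z i + 1) / 2)).
  + move=> i; rewrite normrM normfV (gtr0_norm B4) ler_pdivrMr//.
    have := conjugate_tilt_le lam0 (u_lam i); rewrite -zE.
    have -> : tilt (u i) = ln (z i) by rewrite zE expRK.
    by move/le_trans; apply; lra.
  + by move=> i; have := zM i; lra.
  + rewrite (_ : \sum_i _ = (\sum_i p i * z i + \sum_i p i) / 2).
      by rewrite mass1 p1; lra.
    by rewrite -big_split/= mulr_suml; apply: eq_bigr => i _; ring.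
(* The divergence has mean at most [tau], not 1. Division by [s] gives second moment at most
   [kappa * M * tau / s^2 <= kappa * M]. *)
- have s_rho : rho <= s by rewrite sE le_max lexx orbT.
  have s0 : 0 < s by exact: lt_le_trans s_rho.
  have tau_s2 : tau <= s ^+ 2.
    rewrite -[leLHS]sqr_sqrtr ?(ltW tau0)//.
    rewrite ler_pXn2r ?nnegrE ?sqrtr_ge0 ?(ltW s0)//.
    by rewrite sE le_max lexx.
  have phiM i : jphi (z i) <= kappa * M by rewrite zE jphi_expR_tilt_le.
  have phi0 i : 0 <= jphi (z i) / s by rewrite divr_ge0 ?jphi_ge0 ?(ltW s0).
  have kW : kappa * M <= W by rewrite /W; lra.
  split=> [i|].
    rewrite ger0_norm// ler_pM ?jphi_ge0 ?invr_ge0 ?(ltW s0)//.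
      by rewrite (le_trans (phiM i)).
    by rewrite lef_pV2// posrE.
  apply: (@le_trans _ _ (kappa * M / s * (tau / s))).
    apply: (@moment2_le _ _ _ _ (fun i => jphi (z i) / s)) => //.
    + by rewrite divr_ge0// ltW.
    + by move=> i; rewrite ger0_norm.
    + by move=> i; rewrite ler_pM2r ?invr_gt0.
    + under eq_bigr do rewrite mulrA.
      by rewrite -mulr_suml ler_pM2r ?invr_gt0.
  rewrite (le_trans _ kW)// mulf_div -expr2 ler_pdivrMr ?exprn_gt0//.
  by rewrite ler_wpM2l.
Qed.

End statistics.

Lemma abse_sub_le (R : realType) (x y : \bar R) (a b a' b' e : R) :
  (a%:E <= x)%E -> (x <= b%:E)%E -> (a'%:E <= y)%E -> (y <= b'%:E)%E ->
  b - a' <= e -> b' - a <= e -> (`|x - y| <= e%:E)%E.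
Proof.
case: x => [x| |] //; case: y => [y| |] //.
rewrite !lee_fin => ax xb ay yb h1 h2.
by rewrite ler_norml; apply/andP; split; lra.
Qed.

Theorem corollary4p8 (R : realType) :
  exists2 C : R, 0 < C &
  forall (tau B : R), 0 < tau -> 0 < B ->
  forall (d : measure_display) (T : measurableType d) (P : probability T R)
    (X : T -> R),
    measurable_fun setT X -> (forall w, - B <= X w <= B) ->
  forall (delta epsilon : R), 0 < delta < 1 -> 0 < epsilon <= B ->
  let h := B ^+ 2 * expR (4 * tau * B / epsilon) / epsilon ^+ 2 in
  let Lambda :=
    ln (expR 1 + h + B + B^-1 + epsilon^-1 + tau + tau^-1 + delta^-1) in
  forall n : nat, C * Lambda `^ C * h <= n.+1%:R ->
  forall (d' : measure_display) (S : measurableType d') (Pr : probability S R)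
    (xi : 'I_n.+1 -> {RV Pr >-> T}),
    iid P xi ->
  with_prob_ge Pr (1 - delta)%:E
    [set s | (`| jeffreys_risk P tau X
               - jeffreys_risk (empirical R (fun i => xi i s)) tau X |
              <= epsilon%:E)%E].
Proof.
exists (5 * 16 ^+ 3); first by rewrite mulr_gt0// exprn_gt0.
move=> tau B tau0 B0 d T P X mX XB delta epsilon d01 /[dup] eB /andP[e0 e_le_B].
move=> h Lambda n hn d' S Pr xi iid_xi.
have size_bound := sample_size_bound tau0 B0 eB d01 hn.
move: hn => _; move: @h @Lambda => _ _.
set kappa := 4 * tau * B / epsilon in size_bound.
set rho := epsilon / (16 * B) in size_bound.
have kappa0 : 0 <= kappa by rewrite divr_ge0 ?(ltW e0)// !mulr_ge0// ltW.
have B16 : 0 < 16 * B by rewrite mulr_gt0.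
have rho0 : 0 < rho by rewrite divr_gt0.
have rho1 : rho <= 1 by rewrite ler_pdivrMr// mul1r; lra.
(* All errors below are counted in units of [rho * B], of which 16 are available. *)
have rhoB : 16 * (rho * B) = epsilon by rewrite /rho; field; rewrite gt_eqF.
have eta0 : 0 < rho * B by rewrite mulr_gt0.
have [m [g [v [mg vB vX]]]] := discretize (ltW B0) eta0 mX XB.
have p0 := binp_ge0 g P; have p1 := sum_binp mg P.
(* The cap on [nu] is chosen so that at the cap [lam * tau = epsilon / 2], while always
   [|u i| <= 2 B nu <= kappa]. *)
have nu00 : 0 < 2 * tau / epsilon by rewrite divr_gt0// mulr_gt0.
have [nu [c [/andP[nu0 nu_le] cB]]] := kkt_multipliers p0 p1 vB tau0 nu00.
set u := fun i => nu * v i - c.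
set z := fun i => expR (tilt (u i)) => mass1 cost_tau active.
have z0 i : 0 < z i by exact: expR_gt0.
pose lam := nu^-1; pose mu := c / nu.
have lam0 : 0 < lam by rewrite invr_gt0.
have zE i : lam * (ln (z i) + 1 - (z i)^-1) = v i - mu.
  rewrite /z expRK -expRN tiltE /lam /mu /u mulrBr mulKf ?gt_eqF//.
  by rewrite mulrC.
have u_nu i : `|u i| <= nu * (2 * B).
  rewrite (le_trans (ler_normB _ _))// normrM (gtr0_norm nu0).
  by have := ler_wpM2l (ltW nu0) (vB i); move: cB; lra.
have u_kappa i : `|u i| <= kappa.
  rewrite (le_trans (u_nu i))// (_ : kappa = 2 * tau / epsilon * (2 * B)).
    by rewrite ler_wpM2r// mulr_ge0// ltW.
  by rewrite /kappa; field; rewrite gt_eqF.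
have u_lam i : lam * `|u i| <= 2 * B.
  by rewrite mulrC ler_pdivrMr// mulrC.
pose s := Num.max (Num.sqrt tau) rho.
have s0 : 0 < s by rewrite lt_max rho0 orbT.
have rho01 : 0 < rho <= 1 by rewrite rho0.
have bounds := @statistic_bounds R _ v z lam B s (binp g P) u tau rho kappa
  p0 p1 vB (fun=> erefl) B0 (ltW lam0) tau0 rho01 erefl u_kappa u_lam kappa0
  mass1 cost_tau.
have W0 : 0 < (1 + kappa) * expR kappa by rewrite mulr_gt0 ?expR_gt0//; lra.
pose good (w : {ffun 'I_n.+1 -> 'I_m.+1}) := [forall k,
  \sum_j statistic v z lam B s k (w j) <= n.+1%:R *
    (\sum_i binp g P i * statistic v z lam B s k i + rho)].
have bad_le : \sum_(w | ~~ good w) \prod_j binp g P (w j) <= delta.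
  apply: le_trans size_bound; have := finite_bernstein p0 p1 W0 rho0
    (fun k => (bounds k).1) (fun k => (bounds k).2) n.+1.
  by rewrite card_ord.
have [A [mA AG PA]] := iid_with_prob_ge mg iid_xi bad_le.
(* From here on the outcome [o] is fixed and the argument is deterministic. *)
exists A; split => //; apply: (subset_trans AG) => o /= /forallP good_o.
pose q := binp g (empirical R (fun i => xi i o)).
have q0 := binp_ge0 g (empirical R (fun i => xi i o)).
have q1 := sum_binp mg (empirical R (fun i => xi i o)).
have conc k : \sum_i q i * statistic v z lam B s k i <=
    \sum_i binp g P i * statistic v z lam B s k i + rho.
  rewrite (sum_binp_empirical mg) mulrC ler_pdivrMr ?ltr0n// mulrC.
  by have := good_o k; under eq_bigr do rewrite ffunE.
have conc_z : \sum_i q i * z i <= 1 + rho.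
  by have := conc (inord 0); rewrite /statistic inordK//= mass1.
have conc_zN : 1 - rho <= \sum_i q i * z i.
  have := conc (inord 1); rewrite /statistic inordK//=.
  under eq_bigr do rewrite mulrN; rewrite sumrN.
  under [X in _ <= X + _]eq_bigr do rewrite mulrN.
  by rewrite sumrN mass1; lra.
have conc_vz : \sum_i binp g P i * (v i * z i) - rho * B <=
    \sum_i q i * (v i * z i).
  have := conc (inord 2); rewrite /statistic inordK//=.
  under eq_bigr do rewrite mulrA mulrN; rewrite -mulr_suml sumrN.
  under [X in _ <= X + _]eq_bigr do rewrite mulrA mulrN.
  rewrite -mulr_suml sumrN -(ler_pM2r B0) mulrDl !divfK ?gt_eqF//.
  lra.
have conc_w : \sum_i q i * (lam * (z i - 1 + ln (z i))) <=
    \sum_i binp g P i * (lam * (z i - 1 + ln (z i))) + 4 * (rho * B).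
  have := conc (inord 3); rewrite /statistic inordK//=.
  under eq_bigr do rewrite mulrA; rewrite -mulr_suml.
  under [X in _ <= X + _]eq_bigr do rewrite mulrA.
  have B4 : 0 < 4 * B by rewrite mulr_gt0.
  rewrite -mulr_suml -(ler_pM2r B4) [leRHS]mulrDl !divfK ?gt_eqF//.
  lra.
have conc_phi : \sum_i q i * jphi (z i) <= tau + rho * s.
  have := conc (inord 4); rewrite /statistic inordK//=.
  under eq_bigr do rewrite mulrA; rewrite -mulr_suml.
  under [X in _ <= X + _]eq_bigr do rewrite mulrA.
  rewrite -mulr_suml -(ler_pM2r s0) mulrDl !divfK ?gt_eqF//.
  by move/le_trans; apply; rewrite lerD2r.
have qz : `|\sum_i q i * z i - 1| <= rho.
  by rewrite ler_norml; apply/andP; split; lra.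
have [z' [z'0 z'1 phi' val']] :=
  transfer_weights q0 q1 vB z0 tau0 rho01 erefl qz conc_phi.
have vX1 x : v (g x) - rho * B <= X x.
  by have /andP[h _] := vX x; rewrite (le_trans _ h)// gerBl ltW.
have vX2 x : X x <= v (g x) + rho * B by have /andP[] := vX x.
(* Fenchel equality: [z - 1 + ln z] is [z] times the slope of [jphi] at [z], minus [jphi z]. So dual
   and primal values at [P] differ by [lam * (tau - cost)]. *)
have dualE : \sum_i binp g P i * (lam * (z i - 1 + ln (z i))) =
    \sum_i binp g P i * (v i * z i) - mu - lam * \sum_i binp g P i * jphi (z i).
  transitivity (\sum_i binp g P i * (v i * z i) - mu * (\sum_i binp g P i * z i)
      - lam * \sum_i binp g P i * jphi (z i)); last by rewrite mass1 mulr1.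
  rewrite !mulr_sumr -!sumrB; apply: eq_bigr => i _.
  rewrite /jphi -[v i](subrK mu) -zE; field; exact/lt0r_neq0.
(* Complementary slackness: zero if the constraint is active, else at most
   [lam * tau = epsilon / 2], that is 8 units. *)
have gap : lam * (tau - \sum_i binp g P i * jphi (z i)) <= 8 * (rho * B).
  case: active => [nuE|->]; last by rewrite subrr mulr0; lra.
  apply: (@le_trans _ _ (lam * tau)).
    rewrite ler_wpM2l ?(ltW lam0)// gerBl sumr_ge0// => i _.
    by rewrite mulr_ge0 ?jphi_ge0.
  have -> : lam * tau = epsilon / 2 by rewrite /lam nuE; field; rewrite !gt_eqF.
  by move: rhoB; clear; lra.
rewrite mulrBr in gap.
have lowP := jeffreys_risk_ge mg mX vX1 z0 mass1 cost_tau.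
have uppP := jeffreys_risk_le mg P tau mX vX2 (ltW lam0) z0 zE.
have lowq := jeffreys_risk_ge mg mX vX1 z'0 z'1 phi'.
have uppq := jeffreys_risk_le mg (empirical R (fun i => xi i o)) tau mX vX2
  (ltW lam0) z0 zE.
(* One direction costs 8 (gap) + 2 (rounding) + 4 (transfer) + 1 (value) = 15 units, the other 8 + 2
   + 4 (dual objective) = 14. *)
apply: (abse_sub_le lowP uppP lowq uppq); rewrite -/q.
  by rewrite dualE; move: gap val' conc_vz rhoB eta0; clear; lra.
by move: gap conc_w rhoB eta0; rewrite dualE; clear; lra.
Qed.
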